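(* Let $(X_n,Y_n)$ be the random walk on the hexagonal lattice started at the origin. For every sequence of positive numbers $\{a_n:n\ge1\}$ such that $a_n\to0$ and $na_n\to\infty$ as $n\to\infty$, the sequence $$\left\{\sqrt{na_n}\left(\frac{X_n-\mathbb E(X_n)}{n},\frac{Y_n-\mathbb E(Y_n)}{n}\right):n\ge1\right\}$$ satisfies the large deviation principle on $\mathbb R^2$ with speed $1/a_n$ and good rate function $$\tilde\Lambda^*(x,y)=\sup_{(\lambda_1,\lambda_2)\in\mathbb R^2}\{\lambda_1x+\lambda_2y-\tilde\Lambda(\lambda_1,\lambda_2)\},\qquad \tilde\Lambda(\lambda_1,\lambda_2)=\frac12(\lambda_1,\lambda_2)\,C\binom{\lambda_1}{\lambda_2},$$ where $C=\begin{pmatrix}\sigma_1^2&\sigma_{1,2}\\ \sigma_{1,2}&\sigma_2^2\end{pmatrix}$ with $$\sigma_1^2=\tfrac98a^2[(q_{0,1}+q_{0,2})-(q_{0,1}+q_{0,2})^2+(q_{1,1}+q_{1,2})-(q_{1,1}+q_{1,2})^2],$$ $$\sigma_2^2=\tfrac38a^2[(q_{0,1}+q_{0,2})-(q_{0,1}-q_{0,2})^2+(q_{1,1}+q_{1,2})-(q_{1,1}-q_{1,2})^2],$$ $$\sigma_{1,2}=\tfrac{3\sqrt3}{8}a^2[q_{0,1}(q_{0,1}-1)+q_{0,2}(1-q_{0,2})-q_{1,1}(1-q_{1,1})+q_{1,2}(1-q_{1,2})].$$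
   Context: Fix $a>0$ and nonnegative numbers $q_{i,r}$ ($i=0,1$; $r=0,1,2$) with $\sum_{r=0}^2 q_{i,r}=1$ for $i=0,1$. The vertices of the hexagonal lattice are $\mathscr V_0\cup\mathscr V_1$, where $$\mathscr V_i=\left\{\left(\tfrac32 aj+ia,\ \tfrac{\sqrt3}{2}aj+\sqrt3 ak\right): j,k\in\mathbb Z\right\},\quad i=0,1.$$ $\{(X_n,Y_n):n\in\mathbb N_0\}$ is the time-homogeneous Markov chain on $\mathscr V_0\cup\mathscr V_1$ which, from a vertex $(x,y)\in\mathscr V_i$, moves in one step to $\left(x+a\cos(\tfrac{2\pi r}{3}+i\pi),\ y+a\sin(\tfrac{2\pi r}{3}+i\pi)\right)$ with probability $q_{i,r}$, $r=0,1,2$ (such a point belongs to $\mathscr V_{1-i}$). The initial condition is $(X_0,Y_0)=(0,0)$ almost surely. (The constant $a$ is the lattice spacing and is unrelated to the sequence $a_n$.) A speed is a sequence of positive numbers $v_n\to\infty$. A rate function on a topological space $\mathcal Z$ is a lower semicontinuous $I:\mathcal Z\to[0,\infty]$; it is good if all level sets $\{z:I(z)\le\eta\}$, $\eta\ge0$, are compact. A sequence of $\mathcal Z$-valued random variables $\{Z_n\}$ satisfies the large deviation principle with speed $v_n$ and rate function $I$ if $\liminf_{n\to\infty}\frac1{v_n}\log P(Z_n\in O)\ge-\inf_{z\in O}I(z)$ for all open $O$ and $\limsup_{n\to\infty}\frac1{v_n}\log P(Z_n\in K)\le-\inf_{z\in K}I(z)$ for all closed $K$. *)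

(* Defs.v *)
From HB Require Import structures.
From mathcomp Require Import all_boot all_order all_algebra.
From mathcomp Require Import all_classical all_reals all_analysis.

Set Implicit Arguments.
Unset Strict Implicit.
Unset Printing Implicit Defensive.

Import Order.TTheory GRing.Theory Num.Theory.
Import numFieldNormedType.Exports.

Local Open Scope classical_set_scope.
Local Open Scope ring_scope.

(* All sequences below are indexed by n >= 1; their value at 0 is irrelevant. *)

Definition speed (R : realType) (v : nat -> R) : Prop :=
  (forall n, (0 < n)%N -> 0 < v n) /\ (v @ \oo --> +oo).

Definition rate_function (R : realType) (S : topologicalType)
    (I : S -> \bar R) : Prop :=
  (forall z, (0 <= I z)%E) /\ lower_semicontinuous I.

Definition good_rate_function (R : realType) (S : topologicalType)
    (I : S -> \bar R) : Prop :=
  rate_function I /\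
  forall eta : R, 0 <= eta -> compact [set z | (I z <= eta%:E)%E].

Section large_deviation_principle.
Context (R : realType) (d : measure_display) (T : measurableType d).
Variables (P : probability T R) (S : topologicalType).

Definition borel_random_variable (Z : T -> S) : Prop :=
  forall O : set S, open O -> measurable (Z @^-1` O).

(* [lne] is the extended logarithm: [lne 0 = -oo]; also
   [ereal_inf set0 = +oo]. *)
Definition scaled_log_prob (Z : nat -> T -> S) (v : nat -> R) (A : set S)
    (n : nat) : \bar R :=
  ((v n)^-1%:E * lne (P (Z n @^-1` A)))%E.

Definition LDP (Z : nat -> T -> S) (v : nat -> R) (I : S -> \bar R) : Prop :=
  [/\ forall n, (0 < n)%N -> borel_random_variable (Z n),
      speed v,
      rate_function I,
      forall O : set S, open O ->
        (- ereal_inf (I @` O) <= limn_einf (scaled_log_prob Z v O))%E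
    & forall K : set S, closed K ->
        (limn_esup (scaled_log_prob Z v K) <= - ereal_inf (I @` K))%E].

End large_deviation_principle.

Section hexagonal_lattice.
Context (R : realType).
Variable a : R.

Definition hex_vertices (i : 'I_2) : set (R * R) :=
  [set z | exists j k : int,
     z = (3 / 2 * a * j%:~R + i%:R * a,
          Num.sqrt 3 / 2 * a * j%:~R + Num.sqrt 3 * a * k%:~R)].

Definition hex_step (i : 'I_2) (r : 'I_3) (z : R * R) : R * R :=
  (z.1 + a * cos (2 * pi * r%:R / 3 + i%:R * pi),
   z.2 + a * sin (2 * pi * r%:R / 3 + i%:R * pi)).

Variable q : 'I_2 -> 'I_3 -> R.

Definition cond_prob (d : measure_display) (T : measurableType d)
    (P : probability T R) (A B : set T) : R :=
  fine (P (A `&` B)) / fine (P B).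

(* The Markov property and the transition probabilities are stated together:
   whatever the past path z 0, ..., z n (of positive probability), the step in
   direction r from z n has conditional probability q i r. *)
Record hex_random_walk (d : measure_display) (T : measurableType d)
    (P : probability T R) (X Y : nat -> {RV P >-> R}) : Prop := {
  hex_walk_state : forall n t,
    (hex_vertices 0 `|` hex_vertices 1) (X n t, Y n t) ;
  hex_walk_init : P [set t | (X 0%N t, Y 0%N t) = (0, 0)] = 1%E ;
  hex_walk_markov : forall (n : nat) (z : nat -> R * R) (i : 'I_2) (r : 'I_3),
    let past := [set t | forall k, (k <= n)%N -> (X k t, Y k t) = z k] in
    hex_vertices i (z n) ->
    (0 < P past)%E ->
    cond_prob P [set t | (X n.+1 t, Y n.+1 t) = hex_step i r (z n)] past
      = q i r }.

Definition sigma1sq : R :=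
  9 / 8 * a ^+ 2 *
  ((q 0 1 + q 0 2) - (q 0 1 + q 0 2) ^+ 2
   + (q 1 1 + q 1 2) - (q 1 1 + q 1 2) ^+ 2).

Definition sigma2sq : R :=
  3 / 8 * a ^+ 2 *
  ((q 0 1 + q 0 2) - (q 0 1 - q 0 2) ^+ 2
   + (q 1 1 + q 1 2) - (q 1 1 - q 1 2) ^+ 2).

Definition sigma12 : R :=
  3 * Num.sqrt 3 / 8 * a ^+ 2 *
  (q 0 1 * (q 0 1 - 1) + q 0 2 * (1 - q 0 2)
   - q 1 1 * (1 - q 1 1) + q 1 2 * (1 - q 1 2)).

Definition hex_cov : 'M[R]_2 :=
  \matrix_(i, j) (if i == j then (if i == 0 then sigma1sq else sigma2sq)
                  else sigma12).

Definition Lambda_tilde (l : 'rV[R]_2) : R :=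
  1 / 2 * (l *m hex_cov *m l^T) 0 0.

Definition Lambda_tilde_star (z : R * R) : \bar R :=
  ereal_sup [set (l 0 0 * z.1 + l 0 1 * z.2 - Lambda_tilde l)%:E
            | l in [set: 'rV[R]_2]].

End hexagonal_lattice.

(* Main.v *)
(* The walk alternates between the two vertex classes, so its position after [n]
   steps is a sum of independent increments with two alternating laws, and the
   exponential moments of the rescaled walk factor over the steps. Expanding the
   logarithms to second order at the scale [(n * an n)^(-1/2)], which tends to 0,
   the scaled cumulant generating functions converge to the quadratic form
   [Lambda_tilde], the average over the two laws of half their variances.
   The principle follows as in the Gartner-Ellis theorem: Chernoff bounds over
   finitely many half planes give the upper bound; for the lower bound, a point
   of finite rate is a gradient [C l], and after tilting by [l] the mass
   concentrates there, which needs only the convergence of the generating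
   functions near [l]. No inverse of [C] is used, so [C] may be singular. *)

Require Import Defs.
From HB Require Import structures.
From mathcomp Require Import all_boot all_order all_algebra.
From mathcomp Require Import all_classical all_reals all_analysis.
From mathcomp Require Import measurable_realfun ring lra.

Set Implicit Arguments.
Unset Strict Implicit.
Unset Printing Implicit Defensive.

Import Order.TTheory GRing.Theory Num.Theory.
Import numFieldNormedType.Exports.

Local Open Scope classical_set_scope.
Local Open Scope ring_scope.

(** * Second-order expansion of exponentials and of logarithmic moment generating functions *)

Lemma expR_taylor1 (R : realType) (y : R) : `|y| <= 1 / 2 ->
  0 <= expR y - 1 - y <= 2 * y ^+ 2.
Proof.
move=> hy; have /andP[y1 y2] : - (1 / 2) <= y <= 1 / 2 by rewrite -ler_norml.
have h1 := expR_ge1Dx y.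
apply/andP; split; first by lra.
(* The upper bound comes from [1 - y <= expR (- y)], that is [expR y * (1 - y) <= 1], where [1 - y]
   is at least one half. *)
have h2 := expR_ge1Dx (- y).
have h3 : expR y * (1 - y) <= 1.
  apply: le_trans (_ : expR y * expR (- y) <= 1); last by rewrite expRxMexpNx_1.
  by rewrite ler_wpM2l ?expR_ge0.
nra.
Qed.

(** The remainder [h] vanishes at 0 and its derivative is the first-order remainder, which
    [expR_taylor1] bounds by a square; the mean value theorem between 0 and [y] supplies the third
    factor. *)
Lemma expR_taylor2 (R : realType) (y : R) : `|y| <= 1 / 2 ->
  `|expR y - 1 - y - y ^+ 2 / 2| <= 2 * `|y| ^+ 3.
Proof.
move=> hy.
pose h (x : R) := expR x - 1 - x - x ^+ 2 / 2.
have dh (x : R) : is_derive x 1 h (expR x - 1 - x).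
  rewrite /h; apply: is_derive_eq => /=. rewrite !scaler1 /GRing.scale /=; lra.
have ch : forall A : set R, {within A, continuous h}.
  move=> A; apply: continuous_subspaceT => x.
  by apply/differentiable_continuous/derivable1_diffP; case: (dh x).
have h0 : h 0 = 0 by rewrite /h expR0; lra.
have bnd c : `|c| <= `|y| -> `|expR c - 1 - c| <= 2 * y ^+ 2.
  move=> cy; have /expR_taylor1/andP[c1 c2] := le_trans cy hy.
  rewrite ger0_norm// (le_trans c2)// -(real_normK (num_real c)) -(real_normK (num_real y)).
  by rewrite ler_wpM2l// lerXn2r// nnegrE.
have -> : 2 * `|y| ^+ 3 = (2 * y ^+ 2) * `|y|.
  by rewrite -(real_normK (num_real y)); ring.
rewrite -/(h y); case: (leP 0 y) => y0.
- case: (@MVT_segment _ h (fun x => expR x - 1 - x) 0 y y0) => // c.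
  rewrite in_itv/= => /andP[c0 cy]; rewrite h0 !subr0 => ->.
  by rewrite normrM ler_wpM2r// bnd// !ger0_norm// (le_trans c0).
- case: (@MVT_segment _ h (fun x => expR x - 1 - x) y 0 (ltW y0)) => // c.
  rewrite in_itv/= => /andP[cy c0]; rewrite h0 sub0r sub0r => /(congr1 Num.norm).
  rewrite normrN normrM normrN => ->.
  by rewrite ler_wpM2r// bnd// !ler0_norm ?lerN2// ltW.
Qed.

Section log_mgf.
Context (R : realType) (th : nat -> R).
Hypotheses (th0 : th @ \oo --> 0) (th_gt0 : \forall n \near \oo, 0 < th n).

Lemma expR_second_order (y : R) :
  (fun n => (expR (th n * y) - 1 - th n * y) / th n ^+ 2) @ \oo --> y ^+ 2 / 2.
Proof.
have ty0 : (fun n => 2 * `|y| ^+ 3 * th n) @ \oo --> 0.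
  by rewrite -[0](mulr0 (2 * `|y| ^+ 3)); apply: cvgM => //; exact: cvg_cst.
have near_small : \forall n \near \oo, `|th n * y| <= 1 / 2.
  have : (fun n => th n * y) @ \oo --> 0.
    by rewrite -[0](mul0r y); apply: cvgM => //; exact: cvg_cst.
  by move=> /cvgr0_norm_le; apply; lra.
apply: (squeeze_cvgr (f := fun n => y ^+ 2 / 2 - 2 * `|y| ^+ 3 * th n)
  (h := fun n => y ^+ 2 / 2 + 2 * `|y| ^+ 3 * th n)).
- near=> n.
  have t0 : 0 < th n by near: n.
  have : `|th n * y| <= 1 / 2 by near: n.
  move=> /expR_taylor2; rewrite normrM (gtr0_norm t0) => H.
  rewrite -ler_distl; set E := _ / th n ^+ 2.
  have -> : E - y ^+ 2 / 2 =
      (expR (th n * y) - 1 - th n * y - (th n * y) ^+ 2 / 2) / th n ^+ 2.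
    by rewrite /E; field; lra.
  rewrite normrM normfV (ger0_norm (sqr_ge0 (th n))) ler_pdivrMr ?exprn_gt0//.
  by apply: le_trans H _; rewrite le_eqVlt; apply/orP; left; apply/eqP; ring.
- by rewrite -[X in _ --> X](subr0 (y ^+ 2 / 2)); apply: cvgB => //; exact: cvg_cst.
- by rewrite -[X in _ --> X](addr0 (y ^+ 2 / 2)); apply: cvgD => //; exact: cvg_cst.
Unshelve. all: by end_near. Qed.

(** The hypothesis forces [u n] to tend to 0. Then [u / (1 + u) <= ln (1 + u) <= u] squeezes the
    quotient between two sequences with limit [l]. *)
Lemma ln_second_order (u : nat -> R) (l : R) :
  (fun n => u n / th n ^+ 2) @ \oo --> l ->
  (fun n => ln (1 + u n) / th n ^+ 2) @ \oo --> l.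
Proof.
move=> ul.
have u0 : u @ \oo --> 0.
  have h : (fun n => u n / th n ^+ 2 * (th n * th n)) @ \oo --> 0.
    rewrite -[X in _ --> X](mulr0 l) -[X in l * X](mulr0 0).
    by apply: cvgM => //; exact: cvgM.
  apply: cvg_trans h; apply: near_eq_cvg; near=> n.
  have t0 : 0 < th n by near: n.
  by field; lra.
have u_small : \forall n \near \oo, `|u n| <= 1 / 2.
  by apply: (@cvgr0_norm_le _ _ _ _ _ u u0); lra.
apply: (squeeze_cvgr (f := fun n => u n / th n ^+ 2 * (1 + u n)^-1)
  (h := fun n => u n / th n ^+ 2)) => //.
- near=> n.
  have t0 : 0 < th n by near: n.
  have : `|u n| <= 1 / 2 by near: n.
  rewrite ler_norml => /andP[u1 u2].
  have u3 : 0 < 1 + u n by lra.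
  rewrite mulrAC !ler_pM2r ?invr_gt0 ?exprn_gt0//.
  apply/andP; split; last by apply: le_ln1Dx; lra.
  have e1 : ln (1 + u n) = - ln (1 + (- (u n / (1 + u n)))).
    have -> : 1 + (- (u n / (1 + u n))) = (1 + u n)^-1 by field; lra.
    by rewrite lnV ?posrE// opprK.
  rewrite e1 lerNr; apply: le_ln1Dx.
  have -> : - (u n / (1 + u n)) = (1 + u n)^-1 - 1 by field; lra.
  by rewrite -ltrBlDr opprK addrC subrr invr_gt0.
- rewrite -[X in _ --> X]mulr1 -[X in _ * X]invr1 -[X in X^-1](addr0 1).
  apply: cvgM => //; apply: cvgV; first by rewrite addr0 oner_neq0.
  by apply: cvgD => //; exact: cvg_cst.
Unshelve. all: by end_near. Qed.

(** Since the [y i] are centred, the linear terms cancel and the sum is 1 plus a weighted sum of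
    second-order remainders. *)
Lemma log_mgf_second_order (I : finType) (q y : I -> R) :
  \sum_i q i = 1 -> \sum_i q i * y i = 0 ->
  (fun n => ln (\sum_i q i * expR (th n * y i)) / th n ^+ 2) @ \oo -->
    (\sum_i q i * y i ^+ 2) / 2.
Proof.
move=> q1 qy0.
have -> : (fun n => ln (\sum_i q i * expR (th n * y i)) / th n ^+ 2) =
    (fun n => ln (1 + \sum_i q i * (expR (th n * y i) - 1 - th n * y i)) /
       th n ^+ 2).
  apply/funext => n; congr (ln _ / _).
  under [in RHS]eq_bigr do rewrite !mulrBr mulr1 mulrCA.
  by rewrite !sumrB q1 -mulr_sumr qy0; lra.
apply: ln_second_order.
rewrite mulr_suml.
under [X in X @ _ --> _]eq_fun do rewrite mulr_suml.
apply: cvg_big => [|i _]; first exact: add_continuous.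
rewrite -mulrA; under eq_fun do rewrite -mulrA.
by apply: cvgM; [exact: cvg_cst|exact: expR_second_order].
Qed.

End log_mgf.

(** * Geometry of the steps on the hexagonal lattice *)

Section hexagonal_steps.
Context (R : realType).

(** Twice this angle is [2 * pi] minus the angle, so its cosine c solves 2c^2 - 1 = c; its sign
    selects the root -1/2. *)
Lemma cos_2pi3 : cos (2 * pi / 3) = - (1 / 2) :> R.
Proof.
have p0 := pi_gt0 R.
set x := 2 * pi / 3.
have e : cos (x *+ 2) = cos x.
  have -> : x *+ 2 = pi *+ 2 - x by rewrite /x; lra.
  by rewrite cosB cos2pi sin2pi mul1r mul0r addr0.
have neg : cos x < 0.
  rewrite -(cos_pihalf R) ltr_cos ?in_itv/= /x; lra.
by move: e; rewrite cos_mulr2n => e; nra.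
Qed.

Lemma sin_2pi3 : sin (2 * pi / 3) = Num.sqrt 3 / 2 :> R.
Proof.
have p0 := pi_gt0 R.
have pos : 0 < sin (2 * pi / 3 : R) by apply: sin_gt0_pi; lra.
have e : sin (2 * pi / 3 : R) ^+ 2 = (Num.sqrt 3 / 2) ^+ 2.
  by rewrite sin2cos2 cos_2pi3 expr_div_n sqr_sqrtr//; lra.
by apply/eqP; rewrite -(eqrXn2 (ltn0Sn 1)) ?ltW ?divr_gt0 ?sqrtr_gt0// e.
Qed.

(** Coordinates of the unit step vectors; the rotation by [i * pi] turns into the sign
    [(-1) ^+ i]. *)
Definition dirx (i : 'I_2) (r : 'I_3) : R :=
  (-1) ^+ i * [:: 1; - (1 / 2); - (1 / 2)]`_r.

Definition diry (i : 'I_2) (r : 'I_3) : R :=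
  (-1) ^+ i * [:: 0; Num.sqrt 3 / 2; - (Num.sqrt 3 / 2)]`_r.

Lemma hex_stepE (a : R) (i : 'I_2) (r : 'I_3) (z : R * R) :
  hex_step a i r z = (z.1 + a * dirx i r, z.2 + a * diry i r).
Proof.
have cs (j : 'I_2) (x : R) : cos (x + j%:R * pi) = (-1) ^+ j * cos x /\
    sin (x + j%:R * pi) = (-1) ^+ j * sin x.
  by case: j => -[|[|//]] ? /=; rewrite ?mul0r ?mul1r ?addr0 ?expr0 ?expr1
    ?cosDpi ?sinDpi ?mulN1r ?mul1r.
have c4 : 2 * pi * 2 / 3 = pi *+ 2 - 2 * pi / 3 :> R by lra.
rewrite /hex_step /dirx /diry !(cs i _).1 !(cs i _).2.
case: r => -[|[|[|//]]] ? /=.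
- by rewrite mulr0 mul0r cos0 sin0.
- by rewrite mulr1 cos_2pi3 sin_2pi3.
- rewrite c4 cosB sinB cos2pi sin2pi cos_2pi3 sin_2pi3.
  by rewrite !(mul1r, mul0r, addr0, sub0r).
Qed.

(** This makes the events of the three possible next steps disjoint. *)
Lemma hex_step_inj (a : R) (i : 'I_2) (z : R * R) :
  0 < a -> injective (fun r => hex_step a i r z).
Proof.
move=> a0 r s /=; rewrite !hex_stepE => -[/addrI /(mulfI (lt0r_neq0 a0)) ex].
move=> /addrI /(mulfI (lt0r_neq0 a0)) ey; move: ex ey.
have s0 : (-1) ^+ i != 0 :> R by rewrite signr_eq0.
move=> /(mulfI s0) ex /(mulfI s0) ey; have s3 : 0 < Num.sqrt 3 :> R by rewrite sqrtr_gt0.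
move: ex ey; case: r => -[|[|[|//]]] hr; case: s => -[|[|[|//]]] hs /= ex ey; try exact: val_inj.
all: try (exfalso; lra).
Qed.

(** Each step switches the vertex class and the origin has class 0, so the class at time [n] is the
    parity of [n]. *)
Definition phase (n : nat) : 'I_2 := inord (odd n).

Lemma phaseE n : phase n = odd n :> nat.
Proof. by rewrite /phase inordK//; case: odd. Qed.

Lemma hex_step_vertex (a : R) (n : nat) (r : 'I_3) (z : R * R) :
  hex_vertices a (phase n) z -> hex_vertices a (phase n.+1) (hex_step a (phase n) r z).
Proof.
rewrite /hex_vertices /= => -[j [k ->]]; rewrite hex_stepE /dirx /diry !phaseE /=.
case: r => -[|[|[|//]]] ?; case: odd => /=.
(* Direction 0 keeps the indices [j] and [k]. The other two move [j] up from class 1 and down from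
   class 0; for direction 1, [k] moves the opposite way. *)
- by exists j, k; congr pair; ring.
- by exists j, k; congr pair; ring.
- by exists (j + 1), (k - 1); rewrite !(intrD, intrB) ; congr pair; field.
- by exists (j - 1), (k + 1); rewrite !(intrD, intrB) ; congr pair; field.
- by exists (j + 1), k; rewrite !(intrD, intrB) ; congr pair; field.
- by exists (j - 1), k; rewrite !(intrD, intrB) ; congr pair; field.
Qed.

End hexagonal_steps.

(** * Finite paths as words of directions, and their weights *)

Section words.
Context (R : realType) (a : R) (q : 'I_2 -> 'I_3 -> R).

Fixpoint words (n : nat) : seq (seq 'I_3) :=
  if n is m.+1 then [seq rcons w r | w <- words m, r <- index_enum 'I_3]
  else [:: [::]].

(** Defined for all [k], since the Markov hypothesis takes a path indexed by [nat]; past the end of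
    [w] the default direction 0 is followed. *)
Fixpoint position (w : seq 'I_3) (k : nat) : R * R :=
  if k is m.+1 then hex_step a (phase m) (nth 0 w m) (position w m)
  else (0, 0).

Definition weight (w : seq 'I_3) : R :=
  \prod_(k < size w) q (phase k) (nth 0 w k).

Lemma sum_wordsS (V : nmodType) (n : nat) (F : seq 'I_3 -> V) :
  \sum_(w <- words n.+1) F w = \sum_(w <- words n) \sum_r F (rcons w r).
Proof. by rewrite [LHS]big_allpairs_dep. Qed.

Lemma size_words (n : nat) (w : seq 'I_3) : w \in words n -> size w = n.
Proof.
elim: n w => [|n IH] w /=; first by rewrite inE => /eqP ->.
by move=> /allpairsPdep[v [r [vn _ ->]]]; rewrite size_rcons (IH v).
Qed.

Lemma position_rcons (w : seq 'I_3) (r : 'I_3) (k : nat) :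
  (k <= size w)%N -> position (rcons w r) k = position w k.
Proof.
elim: k => //= k IH kw; rewrite IH ?(ltnW kw)//.
by rewrite nth_rcons kw.
Qed.

Lemma position_last (w : seq 'I_3) (r : 'I_3) :
  position (rcons w r) (size w).+1 =
  hex_step a (phase (size w)) r (position w (size w)).
Proof. by rewrite /= position_rcons// nth_rcons ltnn eqxx. Qed.

Lemma weight_rcons (w : seq 'I_3) (r : 'I_3) :
  weight (rcons w r) = weight w * q (phase (size w)) r.
Proof.
rewrite /weight size_rcons big_ord_recr /= nth_rcons ltnn eqxx.
by congr (_ * _); apply: eq_bigr => k _; rewrite nth_rcons ltn_ord.
Qed.

Lemma position_vertex (w : seq 'I_3) (k : nat) :
  hex_vertices a (phase k) (position w k).
Proof.
elim: k => [|k IH]; last exact: hex_step_vertex.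
by exists 0, 0; rewrite phaseE /= !mulr0 mul0r addr0.
Qed.

(** Distributivity, in the form that makes expectations of products over independent steps
    factor. *)
Lemma sum_words_prod (f : nat -> 'I_3 -> R) (n : nat) :
  \sum_(w <- words n) \prod_(k < size w) f k (nth 0 w k) =
  \prod_(k < n) \sum_r f k r.
Proof.
elim: n => [|n IH]; first by rewrite big_seq1 !big_ord0.
rewrite sum_wordsS big_ord_recr /= -IH mulr_suml.
rewrite big_seq [RHS]big_seq; apply: eq_bigr => w /size_words wn.
rewrite mulr_sumr; apply: eq_bigr => r _.
rewrite size_rcons big_ord_recr /= nth_rcons ltnn eqxx wn.
by congr (_ * _); apply: eq_bigr => k _; rewrite nth_rcons wn ltn_ord.
Qed.

Lemma weight_ge0 (w : seq 'I_3) : (forall i r, 0 <= q i r) -> 0 <= weight w.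
Proof. by move=> q0; apply: prodr_ge0. Qed.

Lemma sum_weight (n : nat) : (forall i, \sum_r q i r = 1) ->
  \sum_(w <- words n) weight w = 1.
Proof.
by move=> q1; rewrite (sum_words_prod (fun k => q (phase k))); apply: big1 => k _; exact: q1.
Qed.

End words.

(** * The law of the walk as a finite weighted sum over words *)

Section walk_law.
Context (R : realType) (a : R) (q : 'I_2 -> 'I_3 -> R).
Context (d : measure_display) (T : measurableType d) (P : probability T R).
Context (X Y : nat -> {RV P >-> R}).
Hypotheses (a_gt0 : 0 < a) (q_ge0 : forall i r, 0 <= q i r).
Hypotheses (q_sum1 : forall i, \sum_(r < 3) q i r = 1).
Hypothesis walk : hex_random_walk a q X Y.

Local Notation Z := (fun n t => (X n t, Y n t)).
Local Notation pos := (position a).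

Definition follows (w : seq 'I_3) : set T :=
  [set t | forall k, (k <= size w)%N -> Z k t = pos w k].

Lemma measurable_walk_at (n : nat) (z : R * R) :
  measurable [set t | Z n t = z].
Proof.
have -> : [set t | Z n t = z] = X n @^-1` [set z.1] `&` Y n @^-1` [set z.2].
  by apply/seteqP; split=> t /=; case: z => x y /=; [case|case=> -> ->].
by apply: measurableI; rewrite -[X in measurable X]setTI;
  apply: measurable_funP => //; exact: measurable_set1.
Qed.

Lemma measurable_follows (w : seq 'I_3) : measurable (follows w).
Proof.
have -> : follows w = \bigcap_(k in [set k | (k <= size w)%N])
    [set t | Z k t = pos w k] by [].
by apply: bigcap_measurable => [|k _]; [exists 0%N|exact: measurable_walk_at].
Qed.

Lemma follows_rcons (w : seq 'I_3) (r : 'I_3) :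
  follows (rcons w r) = [set t | Z (size w).+1 t =
    hex_step a (phase (size w)) r (pos w (size w))] `&` follows w.
Proof.
apply/seteqP; split=> t /=; rewrite /follows /= size_rcons.
- move=> H; split; first by rewrite H// position_last.
  by move=> k kw; rewrite H ?position_rcons// (leq_trans kw).
- move=> [H1 H2] k; rewrite leq_eqVlt => /orP[/eqP ->|].
    by rewrite position_last.
  by rewrite ltnS => kw; rewrite position_rcons//; exact: H2.
Qed.

(** Induction on the last letter: conditioning on the prefix contributes the factor [q] of the last
    step. *)
Lemma prob_follows (w : seq 'I_3) : P (follows w) = (weight q w)%:E.
Proof.
elim/last_ind: w => [|w r IH].
  rewrite /weight big_ord0 -(hex_walk_init walk); congr (P _).
  apply/seteqP; split=> t /=; first by move/(_ 0%N); apply.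
  by move=> H k; rewrite leqn0 => /eqP ->.
have mB := measurable_walk_at (size w).+1
  (hex_step a (phase (size w)) r (pos w (size w))).
rewrite weight_rcons follows_rcons; set B := [set t | _ = _] in mB *.
(* The Markov hypothesis is silent on a prefix of probability zero; there monotonicity of [P] gives
   zero. *)
have [w0|w0] := eqVneq (weight q w) 0.
  rewrite w0 mul0r; apply/eqP; rewrite -measure_le0.
  apply: (@le_trans _ _ (P (follows w))); last by rewrite IH w0.
  by apply: le_measure; rewrite ?inE//; [apply: measurableI|];
    rewrite //; exact: measurable_follows.
have := hex_walk_markov walk (z := pos w) (n := size w) r (position_vertex _ _ _).
have w_gt0 : 0 < weight q w by rewrite lt_neqAle eq_sym w0 weight_ge0.
rewrite -/(follows w) IH lte_fin => /(_ w_gt0).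
rewrite /cond_prob IH /= -/B => /(canRL (divfK w0)) H.
rewrite -[LHS]fineK ?fin_num_measure//; last exact: measurableI mB (measurable_follows w).
by rewrite H mulrC.
Qed.

(** Words of equal length describe disjoint events: at each extension at most one of the three next
    vertices is the one visited. *)
Lemma sum_follows_le1 (n : nat) (t : T) :
  \sum_(w <- words n) \1_(follows w) t <= 1 :> R.
Proof.
elim: n => [|n IH]; first by rewrite big_seq1 indicE; case: (_ \in _).
apply: le_trans IH; rewrite sum_wordsS; apply: ler_sum => w _.
under eq_bigr do rewrite follows_rcons indicI /=.
rewrite -mulr_suml; apply: ler_piMl; first by rewrite indicE.
have [[r0 hr0]|none] := pselect (exists r, Z (size w).+1 t =
    hex_step a (phase (size w)) r (pos w (size w))).
- rewrite (bigD1 r0)//= big1 ?addr0; first by rewrite indicE; case: (_ \in _).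
  move=> r rr0; rewrite indicE memNset// => /= hr.
  by move/eqP: rr0; apply; apply: (hex_step_inj (z := pos w (size w)) a_gt0);
    exact: etrans (esym hr) hr0.
- by rewrite big1// => r _; rewrite indicE memNset// => /= hr; apply: none; exists r.
Qed.

Lemma integrable_indic_follows (c : R) (w : seq 'I_3) :
  P.-integrable setT (fun t => (c * \1_(follows w) t)%:E).
Proof.
under eq_fun do rewrite EFinM.
exact/integrableZl/integrable_indic/measurable_follows.
Qed.

Lemma integrable_sum_follows (n : nat) (c : seq 'I_3 -> R) :
  P.-integrable setT (fun t => (\sum_(w <- words n) c w * \1_(follows w) t)%:E).
Proof.
under eq_fun do rewrite -sumEFin.
by apply: integrable_sum => // w _; exact: integrable_indic_follows.
Qed.

Lemma integral_sum_follows (n : nat) (c : seq 'I_3 -> R) :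
  (\int[P]_t (\sum_(w <- words n) c w * \1_(follows w) t)%:E =
   (\sum_(w <- words n) c w * weight q w)%:E)%E.
Proof.
under eq_integral do rewrite -sumEFin.
rewrite integral_sum//; last by move=> w; exact: integrable_indic_follows.
rewrite -sumEFin; apply: eq_bigr => w _.
have mw := measurable_follows w.
under eq_integral do rewrite EFinM.
rewrite integralZl//; last exact: integrable_indic.
rewrite integral_indic// setIT.
by rewrite EFinM; congr (_ * _)%E; exact: prob_follows.
Qed.

Lemma measurable_sum_follows (n : nat) (c : seq 'I_3 -> R) :
  measurable_fun setT (fun t : T => \sum_(w <- words n) c w * \1_(follows w) t).
Proof.
apply: measurable_sum => w; apply: measurable_funM => //.
exact/measurable_indic/measurable_follows.
Qed.

(** One minus the sum is nonnegative, and its integral is 0 because the weights sum to 1; hence it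
    vanishes almost everywhere. *)
Lemma ae_sum_follows (n : nat) :
  {ae P, forall t, \sum_(w <- words n) \1_(follows w) t = 1 :> R}.
Proof.
pose g t : R := 1 - \sum_(w <- words n) 1 * \1_(follows w) t.
have mg : measurable_fun setT g.
  by apply: measurable_funB => //; exact: measurable_sum_follows.
have g_ge0 t : 0 <= g t.
  rewrite /g subr_ge0; under eq_bigr do rewrite mul1r; exact: sum_follows_le1.
have : ae_eq P setT (EFin \o g) (cst 0).
  apply/ae_eq_integral_abs => //; first exact/measurable_EFinP.
  under eq_integral do rewrite /= ger0_norm//.
  rewrite /g; under eq_integral do rewrite EFinB.
  rewrite integralB_EFin//; last 2 first.
  - by apply/finite_measure_integrable_cst.
  - exact: integrable_sum_follows.
  rewrite integral_sum_follows integral_cst//= probability_setT mule1.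
  under eq_bigr do rewrite mul1r.
  by rewrite sum_weight// subee.
apply: filterS => t /(_ Logic.I) /= [] /eqP.
by rewrite /g subr_eq0 => /eqP ->; apply: eq_bigr => w _; rewrite mul1r.
Qed.

(** Almost surely the indicators of the paths sum to 1, and on each of these events [f (Z n t)] is
    the constant [f (pos w n)]. *)
Lemma expectation_walk (f : R * R -> R) (n : nat) :
  measurable_fun setT (fun t => f (Z n t)) ->
  ('E_P[fun t => f (Z n t)] =
   (\sum_(w <- words n) weight q w * f (pos w n))%:E)%E.
Proof.
move=> mf; rewrite unlock.
under eq_bigr do rewrite mulrC; rewrite -(integral_sum_follows n (fun w => f (pos w n))).
apply: ae_eq_integral => //.
- exact/measurable_EFinP.
- exact/measurable_EFinP/measurable_sum_follows.
apply: filterS (ae_sum_follows n) => t ht _ /=; congr EFin.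
rewrite -[LHS]mulr1 -ht mulr_sumr big_seq [RHS]big_seq.
apply: eq_bigr => w /size_words wn; rewrite indicE.
by case: (boolP (t \in follows w)) => [|_]; rewrite ?mulr0// inE => ->; rewrite ?wn.
Qed.

Lemma prob_walk (B : set (R * R)) (n : nat) : measurable (Z n @^-1` B) ->
  P (Z n @^-1` B) = (\sum_(w <- words n) weight q w * \1_B (pos w n))%:E.
Proof.
move=> mB; rewrite -(@expectation_walk (\1_B) n); last first.
  exact: (measurable_indic mB).
by rewrite -expectation_indic.
Qed.

End walk_law.

(** * Exponential bounds for finitely supported measures *)

Section gartner_ellis.
Context (R : realType) (I : Type) (s : nat -> seq I) (p : I -> R).
Context (z : nat -> I -> R * R) (v : nat -> R) (L : R * R -> R).

Definition dot (l x : R * R) : R := l.1 * x.1 + l.2 * x.2.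

Definition mass (n : nat) (B : set (R * R)) : R :=
  \sum_(i <- s n) p i * \1_B (z n i).

Definition mgf (n : nat) (l : R * R) : R :=
  \sum_(i <- s n) p i * expR (v n * dot l (z n i)).

Hypotheses (p_ge0 : forall i, 0 <= p i) (v_dvg : v @ \oo --> +oo).
Hypothesis mgf_gt0 : forall n l, 0 < mgf n l.
Hypothesis mgf_cvg : forall l, (fun n => ln (mgf n l) / v n) @ \oo --> L l.

Lemma near_speed_gt (A : R) : \forall n \near \oo, A < v n.
Proof. by move: v_dvg => /cvgryPgt; apply. Qed.

(** Eventually the exponent is below [v n * (c / 2)], which tends to minus infinity;
    [1 + x <= expR x] makes this quantitative. *)
Lemma near_expR_speed (u : nat -> R) (c eta : R) :
  u @ \oo --> c -> c < 0 -> 0 < eta ->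
  \forall n \near \oo, expR (v n * u n) <= eta.
Proof.
move=> uc c0 eta0; near=> n.
have un : u n < c / 2 by near: n; apply: (cvgr_lt _ uc); lra.
have v0 : 0 < v n by near: n; exact: near_speed_gt.
have vn : (eta^-1) / - (c / 2) < v n by near: n; exact: near_speed_gt.
rewrite -[leRHS]invrK -[v n * _]opprK expRN lef_pV2 ?posrE ?invr_gt0 ?expR_gt0//.
apply: le_trans (expR_ge1Dx _).
move: vn; rewrite ltr_pdivrMr; last lra.
nra.
Unshelve. all: by end_near. Qed.

Lemma mgfE (n : nat) (l : R * R) : 0 < v n ->
  mgf n l = expR (v n * (ln (mgf n l) / v n)).
Proof. by move=> v0; rewrite mulrC divfK ?gt_eqF// lnK// posrE. Qed.

Lemma le_mass (n : nat) (B : set (R * R)) (f : R * R -> R) :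
  (forall x, \1_B x <= f x) -> mass n B <= \sum_(i <- s n) p i * f (z n i).
Proof. by move=> Bf; apply: ler_sum => i _; rewrite ler_wpM2l. Qed.

(** The function [expR (v n * (dot l x - c))] dominates the indicator of the half plane. *)
Lemma chernoff (n : nat) (l : R * R) (c : R) : 0 < v n ->
  mass n [set x | c < dot l x] <= expR (- (v n * c)) * mgf n l.
Proof.
move=> v0; rewrite /mgf mulr_sumr.
under eq_bigr do rewrite mulrCA -expRD.
apply: (@le_mass n _ (fun x => expR (- (v n * c) + v n * dot l x))) => x.
rewrite indicE; case: (boolP (x \in _)) => [|_]; last exact: expR_ge0.
rewrite inE /= => cx; apply: le_trans (expR_ge1Dx _).
by rewrite lerDl addrC subr_ge0 ler_wpM2l// ltW.
Qed.

Lemma near_mass_half_plane (l : R * R) (M del : R) : 0 < del ->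
  \forall n \near \oo,
    mass n [set x | M < dot l x - L l] <= expR (v n * (del - M)).
Proof.
move=> del0; have Lnear : \forall n \near \oo, ln (mgf n l) / v n < L l + del.
  by apply: (cvgr_lt (L l)); [exact: mgf_cvg|lra].
near=> n.
have v0 : 0 < v n by near: n; exact: near_speed_gt.
have Ln : ln (mgf n l) / v n < L l + del by near: n.
have -> : [set x | M < dot l x - L l] = [set x | M + L l < dot l x].
  by apply/seteqP; split=> x /=; rewrite ltrBrDr.
apply: le_trans (chernoff _ _ v0) _; rewrite mgfE// -expRD ler_expR.
by rewrite -mulrN -mulrDr ler_wpM2l//; lra.
Unshelve. all: by end_near. Qed.

Lemma mass_cover (n : nat) (K : set (R * R)) (F : seq (R * R))
    (H : R * R -> set (R * R)) :
  (forall x, K x -> exists2 l, l \in F & H l x) ->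
  mass n K <= \sum_(l <- F) mass n (H l).
Proof.
move=> KF; rewrite exchange_big /=; under eq_bigr do rewrite -mulr_sumr.
apply: (@le_mass n _ (fun x => \sum_(l <- F) \1_(H l) x)) => x.
rewrite indicE; case: (boolP (x \in K)) => [|_]; last exact: sumr_ge0.
rewrite inE => /KF[l lF Hlx].
rewrite (big_rem l)//= indicE mem_set//= lerDl.
exact: sumr_ge0.
Qed.

Lemma near_mass_le (K : set (R * R)) (M del : R) (F : seq (R * R)) : 0 < del ->
  (forall x, K x -> exists2 l, l \in F & M < dot l x - L l) ->
  \forall n \near \oo, mass n K <= expR (v n * (del - M)).
Proof.
move=> del0 KF.
(* Half of [del] absorbs the error in the convergence of the generating functions, the other half
   the number of half planes, since [size F <= expR (v n * (del / 2))] eventually. *)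
have del2 : 0 < del / 2 by lra.
have near_all : \forall n \near \oo, forall l, l \in F ->
    mass n [set x | M < dot l x - L l] <= expR (v n * (del / 2 - M)).
  elim: F {KF} => [|l F IH]; first by near=> n.
  near=> n => k; rewrite inE => /orP[/eqP ->|].
    by near: n; exact: near_mass_half_plane.
  by move: k; near: n.
near=> n.
have v0 : 0 < v n by near: n; exact: near_speed_gt.
apply: le_trans (mass_cover n (H := fun l => [set x | M < dot l x - L l]) KF) _.
apply: (@le_trans _ _ (\sum_(l <- F) expR (v n * (del / 2 - M)))).
  by rewrite big_seq [leRHS]big_seq; apply: ler_sum; near: n.
have -> : v n * (del - M) = v n * (del / 2) + v n * (del / 2 - M) by lra.
rewrite expRD big_const_seq count_predT iter_addr_0 -[leLHS]mulr_natl.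
rewrite ler_wpM2r ?expR_ge0//.
apply: le_trans (expR_ge1Dx _).
have : (size F)%:R / (del / 2) < v n by near: n; exact: near_speed_gt.
by rewrite ltr_pdivrMr// => /ltW h; rewrite (le_trans h)// lerDr.
Unshelve. all: by end_near. Qed.

Lemma dot_continuous (l : R * R) : continuous (dot l).
Proof.
move=> x; apply: cvgD; apply: cvgM; do ?exact: cvg_cst.
  exact: cvg_fst.
exact: cvg_snd.
Qed.

(* Far away points lie in one of the half planes of the four axis directions,
   which is the exponential tightness of the measures. *)
Lemma finite_half_plane_cover (K : set (R * R)) (M : R) : closed K ->
  (forall x, K x -> exists l, M < dot l x - L l) ->
  exists F : seq (R * R), forall x, K x -> exists2 l, l \in F & M < dot l x - L l.
Proof.
move=> clK KM.
(* This radius is at least [M + L l] for each of the four axis directions [l]. *)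
pose rho := `|M| + `|L (1, 0)| + `|L (-1, 0)| + `|L (0, 1)| + `|L (0, -1)|.
pose box : set (R * R) := `[- rho, rho] `*` `[- rho, rho].
have cpt : compact (K `&` box).
  rewrite setIC; apply: compact_closedI => //.
  by apply: compact_setX; exact: segment_compact.
(* The library declares no pointed topology on a product. *)
pose plane : ptopologicalType := HB.pack (R * R)%type (isPointed.Build (R * R)%type (0, 0)).
have : @compact plane (K `&` box) by [].
rewrite compact_cover => /(_ _ setT (fun l => [set x | M < dot l x - L l])).
case.
- move=> l _; apply: (@open_comp _ _ (fun x => dot l x - L l) [set y | M < y]).
    move=> x _; apply: cvgB; [exact: dot_continuous|exact: cvg_cst].
  exact: open_gt.
- by move=> x [/KM[l lx] _]; exists l.
move=> F _ Fcov; exists ((1, 0) :: (-1, 0) :: (0, 1) :: (0, -1) :: finmap.enum_fset F).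
move=> x Kx; have [bx|nbx] := pselect (box x).
  have [l /= lF lx] := Fcov _ (conj Kx bx).
  by exists l => //; rewrite !inE lF !orbT.
have a1 := ler_norm M; have a2 := ler_norm (L (1, 0)).
have a3 := ler_norm (L (-1, 0)); have a4 := ler_norm (L (0, 1)).
have a5 := ler_norm (L (0, -1)).
have b2 := normr_ge0 (L (1, 0)); have b3 := normr_ge0 (L (-1, 0)).
have b4 := normr_ge0 (L (0, 1)); have b5 := normr_ge0 (L (0, -1)).
case: (ltP rho x.1) => x1.
  by exists (1, 0); rewrite ?inE ?eqxx// /dot /=; rewrite /rho in x1; lra.
case: (ltP x.1 (- rho)) => x2.
  by exists (-1, 0); rewrite ?inE ?eqxx ?orbT// /dot /=; rewrite /rho in x2; lra.
case: (ltP rho x.2) => x3.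
  by exists (0, 1); rewrite ?inE ?eqxx ?orbT// /dot /=; rewrite /rho in x3; lra.
case: (ltP x.2 (- rho)) => x4.
  by exists (0, -1); rewrite ?inE ?eqxx ?orbT// /dot /=; rewrite /rho in x4; lra.
by case: nbx; split; rewrite /= in_itv /=; apply/andP.
Qed.

(* The last hypothesis says that [L] has gradient [x] at [l]. The mass tilted by
   [expR (v n * dot l _)] outside a box around [x] is bounded by four Chernoff
   bounds, whose exponents are negative by this hypothesis. *)
Lemma near_mass_ge (O : set (R * R)) (x l : R * R) (del : R) :
  nbhs x O -> 0 < del ->
  (forall u eps, 0 < eps -> exists2 t, 0 < t &
     L (l.1 + t * u.1, l.2 + t * u.2) < L l + t * (dot u x + eps)) ->
  \forall n \near \oo, expR (v n * (L l - dot l x - del)) <= mass n O.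
Proof.
move=> Ox del0 grad.
(* The box of half-width [eps] around [x] lies in [O], and [dot l] varies on it by at most [del / 2]
   from its value at [x]. *)
have [eps eps0 [epsO epsl]] : exists2 eps, 0 < eps &
    (forall y, `|y.1 - x.1| < eps -> `|y.2 - x.2| < eps -> O y) /\
    eps * (`|l.1| + `|l.2|) <= del / 2.
  move: Ox => /nbhs_ballP[e /= e0 eO].
  have l0 : 0 < 1 + `|l.1| + `|l.2| by rewrite -addrA ltr_wpDr ?addr_ge0.
  set b := 1 + _ + _ in l0; pose e1 := del / 2 / b.
  have e1_gt0 : 0 < e1 by rewrite !divr_gt0.
  have m0 : 0 < Num.min e e1 by rewrite lt_min e0.
  exists (Num.min e e1) => //; split=> [y y1 y2|].
    apply: eO; split; rewrite /ball /= distrC; move: y1 y2; rewrite !lt_min.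
      by move=> /andP[].
    by move=> _ /andP[].
  apply: (@le_trans _ _ (e1 * b)); last by rewrite divfK// gt_eqF.
  apply: ler_pM; rewrite ?addr_ge0 ?ge_min ?lexx ?orbT ?(ltW m0)//.
  by rewrite /b -addrA lerDr.
pose U : seq (R * R) := [:: (1, 0); (-1, 0); (0, 1); (0, -1)].
have [t t0 tL] : exists2 t : R * R -> R, (forall u, 0 < t u) &
    forall u, L (l.1 + t u * u.1, l.2 + t u * u.2) < L l + t u * (dot u x + eps).
  have /choice[t ht] : forall u, exists t, 0 < t /\
      L (l.1 + t * u.1, l.2 + t * u.2) < L l + t * (dot u x + eps).
    by move=> u; have [t] := grad u eps eps0; exists t.
  by exists t => u; have [] := ht u.
pose lu u : R * R := (l.1 + t u * u.1, l.2 + t u * u.2).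
(* The Chernoff bound for each side of the box is compared with the total tilted mass [mgf n l]; the
   factor 1/8 lets the four sides together take at most half of it. *)
have tail u : \forall n \near \oo,
    expR (- (v n * (t u * (dot u x + eps)))) * mgf n (lu u) <= mgf n l / 8.
  have h : (fun n => ln (mgf n (lu u)) / v n - ln (mgf n l) / v n
       - t u * (dot u x + eps)) @ \oo -->
      L (lu u) - L l - t u * (dot u x + eps).
    by apply: cvgB; [exact: cvgB|exact: cvg_cst].
  have neg : L (lu u) - L l - t u * (dot u x + eps) < 0.
    by have := tL u; rewrite -/(lu u); lra.
  have := near_expR_speed h neg (_ : 0 < 1 / 8); move=> /(_ ltac:(lra)) h8.
  near=> n.
  have v0 : 0 < v n by near: n; exact: near_speed_gt.
  rewrite (mgfE _ v0) -expRD (mgfE l v0) -ler_pdivrMl ?expR_gt0// -expRN -expRD.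
  have hn : expR (v n * (ln (mgf n (lu u)) / v n - ln (mgf n l) / v n
       - t u * (dot u x + eps))) <= 1 / 8 by near: n; exact: h8.
  rewrite -[X in _ <= X]mul1r; apply: le_trans hn.
  by rewrite ler_expR; lra.
have Lnear : \forall n \near \oo, L l - del / 4 < ln (mgf n l) / v n.
  by apply: (cvgr_gt (L l)); [exact: mgf_cvg|lra].
near=> n.
have v0 : 0 < v n by near: n; exact: near_speed_gt.
have Ln : L l - del / 4 < ln (mgf n l) / v n by near: n.
have half : expR (v n * (- (del / 4))) <= 1 / 2.
  by near: n; apply: near_expR_speed; [exact: cvg_cst|lra|lra].
have tails : \sum_(u <- U) expR (- (v n * (t u * (dot u x + eps)))) * mgf n (lu u)
    <= mgf n l / 2.
  apply: (@le_trans _ _ (\sum_(u <- U) mgf n l / 8)).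
    rewrite /U !big_cons !big_nil; do ?apply: lerD => //; near: n; exact: tail.
  by rewrite /U !big_cons !big_nil; lra.
have key : expR (- (v n * (dot l x + del / 2))) * (mgf n l -
    \sum_(u <- U) expR (- (v n * (t u * (dot u x + eps)))) * mgf n (lu u)) <= mass n O.
  (* [g] lies below the indicator of [O]. Outside the box one exponential in the sum exceeds the
     tilt, so [g] is at most 0; inside, [g] is at most [expR (v n * (dot l y - dot l x - del / 2))],
     which is at most 1. *)
  pose g (y : R * R) := expR (- (v n * (dot l x + del / 2))) * (expR (v n * dot l y) -
    \sum_(u <- U) expR (- (v n * (t u * (dot u x + eps))) + v n * dot (lu u) y)).
  have -> : expR (- (v n * (dot l x + del / 2))) * (mgf n l -
      \sum_(u <- U) expR (- (v n * (t u * (dot u x + eps)))) * mgf n (lu u)) =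
      \sum_(i <- s n) p i * g (z n i).
    rewrite /g; under [RHS]eq_bigr do rewrite mulrCA mulrBr mulr_sumr.
    rewrite -mulr_sumr; congr (_ * _); rewrite sumrB; congr (_ - _).
    rewrite exchange_big /=; apply: eq_bigr => u _.
    by rewrite /mgf mulr_sumr; apply: eq_bigr => i _; rewrite expRD mulrCA.
  apply: ler_sum => i _; apply: ler_wpM2l => //; move: (z n i) => y {i}.
  have sum_ge u : u \in U -> eps <= dot u y - dot u x -> g y <= 0.
    move=> uU uy; rewrite /g pmulr_rle0 ?expR_gt0// subr_le0.
    rewrite (big_rem u)//=; apply: ler_wpDr; first by apply: sumr_ge0 => *; exact: expR_ge0.
    rewrite ler_expR -subr_ge0.
    have -> : - (v n * (t u * (dot u x + eps))) + v n * dot (lu u) y - v n * dot l y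
        = v n * (t u * (dot u y - dot u x - eps)).
      by rewrite /dot /lu /=; ring.
    by apply: mulr_ge0; [exact: ltW|apply: mulr_ge0; [exact: ltW|lra]].
  have ind0 : g y <= 0 -> g y <= \1_O y by move/le_trans; apply; rewrite indicE.
  case: (ltP `|y.1 - x.1| eps) => [y1|]; last first.
    rewrite ler_normr => /orP[h|h]; apply: ind0.
      by apply: (sum_ge (1, 0)); rewrite ?inE ?eqxx// /dot /=; lra.
    by apply: (sum_ge (-1, 0)); rewrite ?inE ?eqxx ?orbT// /dot /=; lra.
  case: (ltP `|y.2 - x.2| eps) => [y2|]; last first.
    rewrite ler_normr => /orP[h|h]; apply: ind0.
      by apply: (sum_ge (0, 1)); rewrite ?inE ?eqxx ?orbT// /dot /=; lra.
    by apply: (sum_ge (0, -1)); rewrite ?inE ?eqxx ?orbT// /dot /=; lra.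
  rewrite indicE mem_set ?mulr1n; last exact: epsO.
  apply: (@le_trans _ _ (expR (- (v n * (dot l x + del / 2))) * expR (v n * dot l y))).
    rewrite /g ler_wpM2l ?expR_ge0// gerBl.
    by apply: sumr_ge0 => *; exact: expR_ge0.
  rewrite -expRD expR_le1 addrC subr_le0 ler_wpM2l ?(ltW v0)//.
  have d1 : l.1 * (y.1 - x.1) <= `|l.1| * eps.
    by rewrite (le_trans (ler_norm _))// normrM ler_wpM2l// ltW.
  have d2 : l.2 * (y.2 - x.2) <= `|l.2| * eps.
    by rewrite (le_trans (ler_norm _))// normrM ler_wpM2l// ltW.
  by rewrite /dot; lra.
apply: le_trans key.
(* The loss [del] splits into [del / 2] for the variation of [dot l] on the box, [del / 4] for the
   convergence of [mgf n l], and [del / 4] for the factor 1/2 lost to the tails. *)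
have -> : v n * (L l - dot l x - del) = - (v n * (dot l x + del / 2)) +
    (v n * (- (del / 4)) + v n * (L l - del / 4)) by lra.
rewrite expRD ler_wpM2l ?expR_ge0// expRD.
apply: (@le_trans _ _ (1 / 2 * mgf n l)); last by lra.
apply: ler_pM; rewrite ?expR_ge0//.
by rewrite (mgfE l v0) ler_expR ler_wpM2l// ltW.
Unshelve. all: by end_near. Qed.

End gartner_ellis.

(** * Passage from eventual exponential bounds to extended real limits *)

Section extended_limits.
Context (R : realType).
Local Open Scope ereal_scope.

Lemma limn_esup_le_near (u : (\bar R)^nat) (c : \bar R) :
  (\forall n \near \oo, u n <= c) -> limn_esup u <= c.
Proof.
move=> uc; apply: (@le_trans _ _ (ereal_sup (u @` [set n | u n <= c]))).
  by apply: ereal_inf_lbound; exists [set n | u n <= c].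
by apply: ge_ereal_sup => _ [n un <-].
Qed.

Lemma limn_einf_ge_near (u : (\bar R)^nat) (c : \bar R) :
  (\forall n \near \oo, c <= u n) -> c <= limn_einf u.
Proof.
move=> uc; rewrite /limn_einf leeNr; apply: limn_esup_le_near.
by apply: filterS uc => n; rewrite leeN2.
Qed.

Lemma scaled_lne_le (v x c : R) : (0 < v)%R -> (0 <= x)%R ->
  (x <= expR (v * c))%R -> v^-1%:E * lne x%:E <= c%:E.
Proof.
(* When [x] is 0 its extended logarithm is [-oo] and the bound is trivial. *)
move=> v0; rewrite le_eqVlt => /predU1P[<- _|x0 xc].
  by rewrite le0_lneNy// gt0_muleNy ?lte_fin ?invr_gt0// leNye.
rewrite lne_EFin// -EFinM lee_fin ler_pdivrMl//.
by rewrite -[leRHS]expRK ler_ln ?posrE ?expR_gt0.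
Qed.

Lemma scaled_lne_ge (v x c : R) : (0 < v)%R ->
  (expR (v * c) <= x)%R -> c%:E <= v^-1%:E * lne x%:E.
Proof.
move=> v0 xc; have x0 : (0 < x)%R by apply: lt_le_trans xc; exact: expR_gt0.
rewrite lne_EFin// -EFinM lee_fin ler_pdivlMl//.
by rewrite -[leLHS]expRK ler_ln ?posrE ?expR_gt0.
Qed.

End extended_limits.

(** * The Legendre transform as a good rate function *)

Section legendre.
Context (R : realType) (L : R * R -> R).

Definition legendre (x : R * R) : \bar R :=
  ereal_sup [set (dot l x - L l)%:E | l in [set: R * R]].

Lemma legendre_ge (x l : R * R) : ((dot l x - L l)%:E <= legendre x)%E.
Proof. by apply: ereal_sup_ubound; exists l. Qed.

Lemma legendre_gt (x : R * R) (M : R) :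
  (M%:E < legendre x)%E -> exists l, M < dot l x - L l.
Proof. by move=> /ereal_sup_gt[_ [l _ <-]]; rewrite lte_fin; exists l. Qed.

(** A supremum of continuous affine functions is lower semicontinuous. *)
Lemma legendre_lsc : lower_semicontinuous legendre.
Proof.
move=> x M /legendre_gt[l lM]; exists [set y | M < dot l y - L l].
  have : (fun y => dot l y - L l) @ x --> dot l x - L l.
    by apply: cvgB; [exact: dot_continuous|exact: cvg_cst].
  by move/cvgr_gt; apply.
by move=> y /= My; apply: lt_le_trans (legendre_ge y l); rewrite lte_fin.
Qed.

Lemma legendre_rate : L (0, 0) = 0 -> rate_function legendre.
Proof.
move=> L0; split; last exact: legendre_lsc.
by move=> x; apply: le_trans (legendre_ge x (0, 0)); rewrite L0 /dot /= !mul0r addr0 subr0.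
Qed.

(** Testing the supremum at the four axis directions confines the level set to a box, and lower
    semicontinuity makes it closed. *)
Lemma legendre_compact (eta : R) : compact [set x | (legendre x <= eta%:E)%E].
Proof.
pose rho := `|eta| + `|L (1, 0)| + `|L (-1, 0)| + `|L (0, 1)| + `|L (0, -1)|.
pose box : set (R * R) := `[- rho, rho] `*` `[- rho, rho].
have -> : [set x | (legendre x <= eta%:E)%E] =
    box `&` [set x | (legendre x <= eta%:E)%E].
  apply/seteqP; split=> x /=; last by case.
  move=> xeta; split => //.
  have h l : dot l x - L l <= eta by rewrite -lee_fin (le_trans (legendre_ge x l)).
  have h1 := h (1, 0); have h2 := h (-1, 0); have h3 := h (0, 1); have h4 := h (0, -1).
  have a1 := ler_norm eta; have a2 := ler_norm (L (1, 0)).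
  have a3 := ler_norm (L (-1, 0)); have a4 := ler_norm (L (0, 1)).
  have a5 := ler_norm (L (0, -1)).
  have b2 := normr_ge0 (L (1, 0)); have b3 := normr_ge0 (L (-1, 0)).
  have b4 := normr_ge0 (L (0, 1)); have b5 := normr_ge0 (L (0, -1)).
  rewrite /dot /= in h1 h2 h3 h4.
  by split; rewrite /= in_itv /= /rho; apply/andP; split; lra.
apply: compact_closedI; first by apply: compact_setX; exact: segment_compact.
rewrite -[X in closed X]setCK; apply: open_closedC.
have -> : ~` [set x | (legendre x <= eta%:E)%E] = [set x | (eta%:E < legendre x)%E].
  by apply/seteqP; split=> x /=; rewrite ltNge => /negP.
exact: (lower_semicontinuousP _).1 legendre_lsc eta.
Qed.

End legendre.

(** * The large deviation principle from convergent generating functions *)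

Section gartner_ellis_ldp.
Context (R : realType) (I : Type) (s : nat -> seq I) (p : I -> R).
Context (z : nat -> I -> R * R) (v : nat -> R) (L : R * R -> R).
Context (d : measure_display) (T : measurableType d) (P : probability T R).
Context (Z : nat -> T -> R * R).
Hypotheses (p_ge0 : forall i, 0 <= p i) (speed_v : speed v).
Hypothesis mgf_gt0 : forall n l, 0 < mgf s p z v n l.
Hypothesis mgf_cvg : forall l, (fun n => ln (mgf s p z v n l) / v n) @ \oo --> L l.
Hypothesis L0 : L (0, 0) = 0.
Hypothesis Z_meas : forall n, (0 < n)%N -> borel_random_variable (Z n).
Hypothesis Z_law : forall n (B : set (R * R)), (0 < n)%N ->
  P (Z n @^-1` B) = (mass s p z n B)%:E.
Hypothesis exposed : forall x, (legendre L x < +oo)%E -> exists l : R * R,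
  forall u eps, 0 < eps -> exists2 t, 0 < t &
     L (l.1 + t * u.1, l.2 + t * u.2) < L l + t * (dot u x + eps).

(** Points of infinite rate impose nothing. At a point [x] of finite rate, tilting by its [l] gives
    the exponent [L l - dot l x], which is at least [- legendre L x]. *)
Lemma gartner_ellis_lower (O : set (R * R)) : open O ->
  (- ereal_inf (legendre L @` O) <= limn_einf (scaled_log_prob P Z v O))%E.
Proof.
move=> oO; rewrite leeNl; apply: le_ereal_inf_tmp => _ [x Ox <-].
rewrite leeNl.
have [->|xfin] := eqVneq (legendre L x) +oo%E; first by rewrite leNye.
have [|l grad] := exposed (x := x); first by rewrite ltey.
apply/lee_subgt0Pr => e e0.
apply: (@le_trans _ _ (L l - dot l x - e)%:E).
  rewrite EFinB; apply: leeD2r; rewrite leeNl -EFinN opprB.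
  exact: legendre_ge.
apply: limn_einf_ge_near.
have near_ge : \forall n \near \oo,
    expR (v n * (L l - dot l x - e)) <= mass s p z n O.
  apply: (near_mass_ge p_ge0 speed_v.2 mgf_gt0 mgf_cvg _ e0 grad).
  exact: open_nbhs_nbhs.
near=> n; have n0 : (0 < n)%N by near: n; exact: nbhs_infty_gt.
rewrite /scaled_log_prob Z_law//; apply: scaled_lne_ge; first exact: speed_v.1.
by near: n.
Unshelve. all: by end_near. Qed.

(** For any real [M] below the infimum of the rate over [K], finitely many half planes of exponent
    [M] cover [K]; then [M] increases to the infimum. *)
Lemma gartner_ellis_upper (K : set (R * R)) : closed K ->
  (limn_esup (scaled_log_prob P Z v K) <= - ereal_inf (legendre L @` K))%E.
Proof.
move=> cK; have upper M : (M%:E < ereal_inf (legendre L @` K))%E ->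
    (limn_esup (scaled_log_prob P Z v K) <= (- M)%:E)%E.
  move=> MK; have [x Kx|F KF] := finite_half_plane_cover (L := L) (M := M) cK.
    apply: legendre_gt; apply: lt_le_trans MK _.
    by apply: ereal_inf_lbound; exists x.
  apply/lee_addgt0Pr => e e0; rewrite -EFinD; apply: limn_esup_le_near.
  have near_le := near_mass_le p_ge0 speed_v.2 mgf_gt0 mgf_cvg e0 KF.
  near=> n; have n0 : (0 < n)%N by near: n; exact: nbhs_infty_gt.
  rewrite /scaled_log_prob Z_law//; apply: scaled_lne_le; first exact: speed_v.1.
    by apply: sumr_ge0 => i _; rewrite mulr_ge0// indicE.
  by rewrite addrC; near: n.
have inf_ge0 : (0 <= ereal_inf (legendre L @` K))%E.
  by apply: le_ereal_inf_tmp => _ [x _ <-]; exact: (legendre_rate L0).1.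
(* A finite infimum is approached by [r - e]; if it is [+oo], every real [M] is admissible and the
   upper limit is [-oo]. *)
case: (ereal_inf _) inf_ge0 upper => [r _ upper|_ upper|//].
  apply/lee_addgt0Pr => e e0.
  have -> : ((- r%:E) + e%:E = (- (r - e))%:E)%E by rewrite opprB addrC EFinD EFinN.
  by apply: upper; rewrite lte_fin gtrBl.
rewrite leeNy_eq; apply/eqP/eq_ninfty => M.
by rewrite -[M]opprK; apply: upper; rewrite ltry.
Unshelve. all: by end_near. Qed.

Theorem gartner_ellis : LDP P Z v (legendre L).
Proof.
split=> //; first exact: legendre_rate.
  exact: gartner_ellis_lower.
exact: gartner_ellis_upper.
Qed.

End gartner_ellis_ldp.

(** * Gradients and Legendre transforms of possibly degenerate quadratic forms *)

Section quadratic.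
Context (R : realType) (A B C : R).

Definition quadratic (l : R * R) : R :=
  (A * l.1 ^+ 2 + 2 * B * l.1 * l.2 + C * l.2 ^+ 2) / 2.

(** The increment along [t * u] is its linear part plus [t ^+ 2 * quadratic u], so it suffices that
    [t * quadratic u < eps]. *)
Lemma quadratic_gradient (l u : R * R) (eps : R) : 0 < eps ->
  exists2 t, 0 < t & quadratic (l.1 + t * u.1, l.2 + t * u.2) <
    quadratic l + t * (dot u (A * l.1 + B * l.2, B * l.1 + C * l.2) + eps).
Proof.
move=> eps0; have q0 : 0 < `|quadratic u| + 1 by rewrite ltr_wpDl.
exists (eps / (`|quadratic u| + 1)); first by rewrite divr_gt0.
set t := eps / _; have t0 : 0 < t by rewrite divr_gt0.
have te : t * quadratic u < eps.
  rewrite /t mulrAC ltr_pdivrMr// ltr_pM2l//.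
  by rewrite (le_lt_trans (ler_norm _))// ltrDl.
rewrite -subr_gt0.
have -> : quadratic l + t * (dot u (A * l.1 + B * l.2, B * l.1 + C * l.2) + eps) -
    quadratic (l.1 + t * u.1, l.2 + t * u.2) = t * (eps - t * quadratic u).
  by rewrite /quadratic /dot /=; field.
by rewrite mulr_gt0// subr_gt0.
Qed.

(** If [dot k x] were nonzero, [dot l x - L l] would take every real value along the line of
    multiples of [k], and the transform would be infinite. *)
Lemma legendre_kernel (L : R * R -> R) (x k : R * R) :
  (legendre L x < +oo)%E -> (forall t, L (t * k.1, t * k.2) = 0) -> dot k x = 0.
Proof.
move=> xfin Lk; apply/eqP/negPn/negP => kx.
have h M : (M%:E <= legendre L x)%E.
  pose t := M / dot k x.
  apply: le_trans (legendre_ge L x (t * k.1, t * k.2)).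
  have -> : dot (t * k.1, t * k.2) x = t * dot k x by rewrite /dot /=; ring.
  by rewrite Lk subr0 lee_fin divfK.
by move: xfin; rewrite (eq_infty h) ltxx.
Qed.

(* A symmetric matrix maps onto the orthogonal complement of its kernel. *)
Lemma legendre_quadratic_gradient (x : R * R) : (legendre quadratic x < +oo)%E ->
  exists l : R * R, x = (A * l.1 + B * l.2, B * l.1 + C * l.2).
Proof.
move=> xfin; case: x xfin => x y xfin.
have [det0|det0] := eqVneq (A * C - B ^+ 2) 0; last first.
  (* Cramer's rule. *)
  exists ((C * x - B * y) / (A * C - B ^+ 2), (A * y - B * x) / (A * C - B ^+ 2)).
  by congr pair; rewrite /=; field.
have [A0|A0] := eqVneq A 0.
  have B0 : B = 0.
    by apply/eqP; rewrite -sqrf_eq0 -oppr_eq0 -[X in _ == X]det0 A0 mul0r sub0r.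
  have x0 : x = 0.
    rewrite -[LHS](_ : dot (1, 0) (x, y) = x); last by rewrite /dot /=; ring.
    apply: (legendre_kernel xfin) => t.
    by rewrite /quadratic /= A0 B0; ring.
  have [C0|C0] := eqVneq C 0.
    have y0 : y = 0.
      rewrite -[LHS](_ : dot (0, 1) (x, y) = y); last by rewrite /dot /=; ring.
      apply: (legendre_kernel xfin) => t.
      by rewrite /quadratic /= C0 B0; ring.
    by exists (0, 0); rewrite x0 y0 /= !mulr0 addr0.
  by exists (0, y / C); rewrite /= A0 B0 x0; congr pair; field.
(* With zero determinant and [A] nonzero, [(- B, A)] spans the kernel of the matrix. *)
have : dot (- B, A) (x, y) = 0.
  apply: (legendre_kernel xfin) => t /=.
  have -> : quadratic (t * - B, t * A) = t ^+ 2 * A * (A * C - B ^+ 2) / 2.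
    by rewrite /quadratic /=; field.
  by rewrite det0 mulr0 mul0r.
rewrite /dot /= => k0; exists (x / A, 0); congr pair; rewrite /=; first by field.
by rewrite mulr0 addr0; apply: (mulfI A0); rewrite -[LHS]subr0 -k0; field.
Qed.

End quadratic.

Lemma Lambda_tilde_starE (R : realType) (a : R) (q : 'I_2 -> 'I_3 -> R) :
  Lambda_tilde_star a q =
  legendre (quadratic (sigma1sq a q) (sigma12 a q) (sigma2sq a q)).
Proof.
have E (l : 'rV[R]_2) : Lambda_tilde a q l =
    quadratic (sigma1sq a q) (sigma12 a q) (sigma2sq a q) (l 0 0, l 0 1).
  rewrite /Lambda_tilde /quadratic !mxE !big_ord_recl !big_ord0 !mxE.
  rewrite !big_ord_recl !big_ord0 !mxE /=.
  have -> : lift ord0 ord0 = 1 :> 'I_2 by apply: val_inj.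
  have -> : ord0 = 0 :> 'I_2 by apply: val_inj.
  by rewrite /=; field.
apply/funext => z; congr ereal_sup; apply/seteqP; split=> _ [l _ <-].
  by exists (l 0 0, l 0 1) => //; rewrite E.
exists (\row_j (if j == 0 then l.1 else l.2)) => //.
by rewrite E !mxE /=; case: l.
Qed.

(** * Averages over the alternating vertex classes *)

Section phase_average.
Context (R : realType).

Lemma sum_phase (h : 'I_2 -> R) (n : nat) :
  \sum_(k < n) h (phase k) = (uphalf n)%:R * h 0 + n./2%:R * h 1.
Proof.
elim: n => [|n IH]; first by rewrite big_ord0 !mul0r addr0.
rewrite big_ord_recr /= IH uphalf_half.
have -> : h (phase n) = (~~ odd n)%:R * h 0 + (odd n)%:R * h 1.
  case E: (odd n).
    by rewrite mul0r add0r mul1r; congr h; apply: val_inj; rewrite /= phaseE E.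
  by rewrite mul1r mul0r addr0; congr h; apply: val_inj; rewrite /= phaseE E.
by rewrite !natrD; case: (odd n) => /=; ring.
Qed.

Lemma cvg_half : (fun n => n./2%:R / n%:R) @ \oo --> (1 / 2 : R).
Proof.
have inv0 : (fun n => (n%:R)^-1) @ \oo --> (0 : R).
  apply/gtr0_cvgV0; last exact: cvgr_idn.
  by near=> n; rewrite ltr0n; near: n; exact: nbhs_infty_gt.
apply: (squeeze_cvgr (f := fun n => 1 / 2 - n%:R^-1) (h := fun=> 1 / 2)).
- near=> n; have n0 : 0 < n%:R :> R by rewrite ltr0n; near: n; exact: nbhs_infty_gt.
  have e : n%:R = (odd n)%:R + 2 * n./2%:R :> R.
    by rewrite -{1}(odd_double_half n) natrD -mul2n natrM.
  have o0 : 0 <= (odd n)%:R :> R by rewrite ler0n.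
  have o1 : (odd n)%:R <= 1 :> R by rewrite lern1 leq_b1.
  apply/andP; split.
    rewrite ler_pdivlMr// mulrBl mulVf ?gt_eqF//; lra.
  by rewrite ler_pdivrMr//; lra.
- by rewrite -[X in _ --> X]subr0; apply: cvgB => //; exact: cvg_cst.
- exact: cvg_cst.
Unshelve. all: by end_near. Qed.

(** Each class accounts for asymptotically half of the steps. The terms depend on [n] because all
    [n] steps are taken at the common scale of time [n]. *)
Lemma cvg_phase_average (g : 'I_2 -> nat -> R) (c : 'I_2 -> R) :
  (forall i, g i @ \oo --> c i) ->
  (fun n => (\sum_(k < n) g (phase k) n) / n%:R) @ \oo --> (c 0 + c 1) / 2.
Proof.
move=> gc.
have h : (fun n => (1 - n./2%:R / n%:R) * g 0 n + n./2%:R / n%:R * g 1 n) @ \oo -->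
    (1 - 1 / 2) * c 0 + 1 / 2 * c 1.
  apply: cvgD; apply: cvgM; try exact: gc; last exact: cvg_half.
  by apply: cvgB; [exact: cvg_cst|exact: cvg_half].
have -> : (c 0 + c 1) / 2 = (1 - 1 / 2) * c 0 + 1 / 2 * c 1 by field.
apply: cvg_trans h; apply: near_eq_cvg; near=> n.
have n0 : n%:R != 0 :> R by rewrite pnatr_eq0 -lt0n; near: n; exact: nbhs_infty_gt.
rewrite (sum_phase (fun i => g i n)).
have -> : (uphalf n)%:R = n%:R - n./2%:R :> R.
  apply/eqP; rewrite eq_sym subr_eq -natrD uphalf_half -addnA addnn.
  by rewrite odd_double_half.
by field.
Unshelve. all: by end_near. Qed.

End phase_average.

(** * Means, variances and moment generating functions of the increments *)

Section walk_log_mgf.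
Context (R : realType) (a : R) (q : 'I_2 -> 'I_3 -> R).
Hypothesis q_ge0 : forall i r, 0 <= q i r.
Hypothesis q_sum1 : forall i, \sum_(r < 3) q i r = 1.

Definition increment (l : R * R) (i : 'I_2) (r : 'I_3) : R :=
  dot l (a * dirx R i r, a * diry R i r).

Definition drift (l : R * R) (i : 'I_2) : R := \sum_r q i r * increment l i r.

Lemma dot_hex_step (l : R * R) (i : 'I_2) (r : 'I_3) (z : R * R) :
  dot l (hex_step a i r z) = dot l z + increment l i r.
Proof. by rewrite hex_stepE /increment /dot /=; ring. Qed.

Lemma dot_position (l : R * R) (w : seq 'I_3) (n : nat) :
  dot l (position a w n) = \sum_(k < n) increment l (phase k) (nth 0 w k).
Proof.
elim: n => [|n IH]; first by rewrite big_ord0 /dot /= !mulr0 addr0.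
by rewrite big_ord_recr /= dot_hex_step IH.
Qed.

Lemma mean_position (l : R * R) (n : nat) :
  \sum_(w <- words n) weight q w * dot l (position a w n) =
  \sum_(k < n) drift l (phase k).
Proof.
elim: n => [|n IH]; first by rewrite big_seq1 big_ord0 /dot /= !mulr0 addr0 mulr0.
transitivity (\sum_(k < n) drift l (phase k) + drift l (phase n)); last first.
  by rewrite big_ord_recr.
rewrite sum_wordsS -IH -[X in _ = _ + X]mul1r -(sum_weight n q_sum1) mulr_suml.
rewrite -big_split big_seq [RHS]big_seq; apply: eq_bigr => w /size_words wn.
transitivity (\sum_r (weight q w * dot l (position a w n) * q (phase n) r +
    weight q w * (q (phase n) r * increment l (phase n) r))).
  apply: eq_bigr => r _; rewrite weight_rcons -wn position_last dot_hex_step.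
  by ring.
by rewrite big_split -!mulr_sumr q_sum1 mulr1.
Qed.

Definition step_mgf (l : R * R) (th : R) (i : 'I_2) : R :=
  \sum_r q i r * expR (th * (increment l i r - drift l i)).

(** An increment depends on the phase and the direction but not on the position, so the centred
    exponential is a product over the steps and [sum_words_prod] applies. *)
Lemma word_mgf (l : R * R) (th : R) (n : nat) :
  \sum_(w <- words n) weight q w *
    expR (th * (dot l (position a w n) - \sum_(k < n) drift l (phase k))) =
  \prod_(k < n) step_mgf l th (phase k).
Proof.
pose f (k : nat) r := q (phase k) r *
  expR (th * (increment l (phase k) r - drift l (phase k))).
rewrite -(sum_words_prod f n) big_seq [RHS]big_seq.
apply: eq_bigr => w /size_words wn.
by rewrite /weight wn big_split /= -expR_sum dot_position -sumrB mulr_sumr.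
Qed.

Lemma step_mgf_gt0 (l : R * R) (th : R) (i : 'I_2) : 0 < step_mgf l th i.
Proof.
rewrite lt_neqAle eq_sym sumr_ge0 ?andbT; last by move=> r _; rewrite mulr_ge0 ?expR_ge0.
rewrite psumr_neq0; last by move=> r _; rewrite mulr_ge0 ?expR_ge0.
have : \sum_r q i r != 0 by rewrite q_sum1 oner_neq0.
rewrite psumr_neq0// => /hasP[r _ /andP[_ qr]].
by apply/hasP; exists r; rewrite ?mem_index_enum//= mulr_gt0 ?expR_gt0.
Qed.

Lemma ln_prod_step_mgf (l : R * R) (th : R) (n : nat) :
  ln (\prod_(k < n) step_mgf l th (phase k)) =
  \sum_(k < n) ln (step_mgf l th (phase k)).
Proof.
elim: n => [|n IH]; first by rewrite !big_ord0 ln1.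
rewrite !big_ord_recr /= lnM ?posrE ?step_mgf_gt0 ?IH//.
by apply: prodr_gt0 => k _; exact: step_mgf_gt0.
Qed.

(** The mean of the two variances is the form of [hex_cov] at [l], and [quadratic] is half that
    form; hence the factor 4. *)
Lemma variance_sum (l : R * R) :
  \sum_r q 0 r * (increment l 0 r - drift l 0) ^+ 2 +
  \sum_r q 1 r * (increment l 1 r - drift l 1) ^+ 2 =
  4 * quadratic (sigma1sq a q) (sigma12 a q) (sigma2sq a q) l.
Proof.
have s3 : Num.sqrt 3 ^+ 2 = 3 :> R by rewrite sqr_sqrtr.
have q00 : q 0 0 = 1 - q 0 1 - q 0 2.
  rewrite -(q_sum1 0) !big_ord_recl big_ord0.
  have -> : lift ord0 ord0 = 1 :> 'I_3 by apply: val_inj.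
  have -> : lift ord0 (lift ord0 ord0) = 2 :> 'I_3 by apply: val_inj.
  by rewrite /=; ring.
have q10 : q 1 0 = 1 - q 1 1 - q 1 2.
  rewrite -(q_sum1 1) !big_ord_recl big_ord0.
  have -> : lift ord0 ord0 = 1 :> 'I_3 by apply: val_inj.
  have -> : lift ord0 (lift ord0 ord0) = 2 :> 'I_3 by apply: val_inj.
  by rewrite /=; ring.
rewrite /drift /increment /dot /dirx /diry !big_ord_recl !big_ord0.
have -> : lift ord0 ord0 = 1 :> 'I_3 by apply: val_inj.
have -> : lift ord0 (lift ord0 ord0) = 2 :> 'I_3 by apply: val_inj.
have -> : ord0 = 0 :> 'I_3 by apply: val_inj.
rewrite q00 q10 /= !expr0 !expr1 /quadratic /sigma1sq /sigma12 /sigma2sq.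
(* Restoring the square of [Num.sqrt 3] turns the goal into an identity in a free variable [s]. *)
have -> : 3 / 8 * a ^+ 2 = Num.sqrt 3 ^+ 2 / 8 * a ^+ 2 by rewrite s3.
move: (Num.sqrt 3) => s; by field.
Qed.

End walk_log_mgf.

(** * The walk at the moderate deviation scale *)

Section walk_moderate_deviations.
Context (R : realType) (a : R) (q : 'I_2 -> 'I_3 -> R).
Context (d : measure_display) (T : measurableType d) (P : probability T R).
Context (X Y : nat -> {RV P >-> R}).
Hypotheses (a_gt0 : 0 < a) (q_ge0 : forall i r, 0 <= q i r).
Hypothesis q_sum1 : forall i, \sum_(r < 3) q i r = 1.
Hypothesis walk : hex_random_walk a q X Y.
Context (an : nat -> R).
Hypothesis an_gt0 : forall n, (0 < n)%N -> 0 < an n.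
Hypothesis an_to0 : an @ \oo --> 0.
Hypothesis nan_toy : (fun n => n%:R * an n) @ \oo --> +oo.

(** The walk takes countably many values, so the preimage of any set is a countable union of
    measurable events. *)
Lemma measurable_walk (B : set (R * R)) (n : nat) :
  measurable ((fun t => (X n t, Y n t)) @^-1` B).
Proof.
pose vertex (u : 'I_2 * (int * int)) : R * R :=
  (3 / 2 * a * u.2.1%:~R + u.1%:R * a,
   Num.sqrt 3 / 2 * a * u.2.1%:~R + Num.sqrt 3 * a * u.2.2%:~R).
have -> : (fun t => (X n t, Y n t)) @^-1` B = \bigcup_u
    (if pselect (B (vertex u)) then [set t | (X n t, Y n t) = vertex u] else set0).
  apply/seteqP; split=> t /=.
    move=> Bt; have [i [j [k e]]] : exists i : 'I_2, hex_vertices a i (X n t, Y n t).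
      by have [] := hex_walk_state walk n t; [exists 0|exists 1].
    exists (i, (j, k)) => //; case: pselect => [_|] /=; first exact: e.
    by apply; rewrite /vertex /= -e.
  by move=> [u _]; case: pselect => //= Bu ->.
apply: countable_bigcupT_measurable => [|u]; first exact: countableP.
by case: (pselect (B (vertex u))) => _ /=; [exact: measurable_walk_at|exact: measurable0].
Qed.

Lemma expectation_position (l : R * R) (n : nat) (Z : T -> R) :
  measurable_fun setT Z -> (forall t, Z t = dot l (X n t, Y n t)) ->
  fine 'E_P[Z] = \sum_(k < n) drift a q l (phase k).
Proof.
move=> mZ ZE.
have -> : Z = (fun t => dot l (X n t, Y n t)) by exact/funext.
rewrite (expectation_walk a_gt0 q_ge0 q_sum1 walk (f := dot l)).
  by rewrite /= mean_position.
by move: mZ; congr (measurable_fun _ _); exact/funext.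
Qed.

Lemma driftE (l : R * R) (i : 'I_2) :
  drift a q l i = l.1 * drift a q (1, 0) i + l.2 * drift a q (0, 1) i.
Proof.
rewrite /drift !mulr_sumr -big_split; apply: eq_bigr => r _.
by rewrite /increment /dot /=; ring.
Qed.

Definition rescale (n : nat) (x : R * R) : R * R :=
  (Num.sqrt (n%:R * an n) * ((x.1 - fine 'E_P[X n]) / n%:R),
   Num.sqrt (n%:R * an n) * ((x.2 - fine 'E_P[Y n]) / n%:R)).

Definition endpoint (n : nat) (w : seq 'I_3) : R * R :=
  rescale n (position a w n).

Let theta (n : nat) : R := (Num.sqrt (n%:R * an n))^-1.

Lemma theta_gt0 (n : nat) : (0 < n)%N -> 0 < theta n.
Proof. by move=> n0; rewrite invr_gt0 sqrtr_gt0 mulr_gt0 ?ltr0n// an_gt0. Qed.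

Lemma near_theta_gt0 : \forall n \near \oo, 0 < theta n.
Proof. by near=> n; apply: theta_gt0; near: n; exact: nbhs_infty_gt. Unshelve. all: by end_near. Qed.

Lemma theta_cvg0 : theta @ \oo --> 0.
Proof.
apply/gtr0_cvgV0.
  near=> n; rewrite -invr_gt0; near: n; exact: near_theta_gt0.
apply/cvgryPgt => A; near=> n.
have : (A + 1) ^+ 2 < n%:R * an n by near: n; move: nan_toy => /cvgryPgt; exact.
rewrite -ltr_sqrt; last first.
  by rewrite mulr_gt0 ?an_gt0// ?ltr0n; near: n; exact: nbhs_infty_gt.
rewrite sqrtr_sqr; apply: lt_trans.
by rewrite (lt_le_trans _ (ler_norm _))// ltrDl.
Unshelve. all: by end_near. Qed.

(** Thus dividing by the speed amounts to dividing by [theta n ^+ 2] and averaging over [n]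
    steps. *)
Lemma theta_sqr (n : nat) : (0 < n)%N -> an n = (n%:R * theta n ^+ 2)^-1.
Proof.
move=> n0; have an0 := an_gt0 n0; have n1 : 0 < n%:R :> R by rewrite ltr0n.
by rewrite exprVn sqr_sqrtr ?mulr_ge0 ?ltW//; field; rewrite !gt_eqF.
Qed.

(** Multiplying the normalisation [Num.sqrt (n%:R * an n) / n%:R] by the speed leaves exactly
    [theta n], the small parameter of the expansion. *)
Lemma dot_endpoint (l : R * R) (n : nat) (w : seq 'I_3) : (0 < n)%N ->
  1 / an n * dot l (endpoint n w) =
  theta n * (dot l (position a w n) - \sum_(k < n) drift a q l (phase k)).
Proof.
move=> n0; have an0 := an_gt0 n0; have n1 : 0 < n%:R :> R by rewrite ltr0n.
under eq_bigr do rewrite driftE.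
rewrite big_split -!mulr_sumr /endpoint /rescale.
rewrite -(expectation_position (Z := X n)) => [||t]; last 2 first.
- exact: measurable_funP.
- by rewrite /dot /=; ring.
rewrite -(expectation_position (Z := Y n)) => [||t]; last 2 first.
- exact: measurable_funP.
- by rewrite /dot /=; ring.
have s0 : 0 < Num.sqrt (n%:R * an n) by rewrite -invr_gt0; exact: theta_gt0.
have -> : theta n = Num.sqrt (n%:R * an n) / (n%:R * an n).
  rewrite -[X in _ / X](@sqr_sqrtr _ (n%:R * an n)) ?mulr_ge0 ?ltW//.
  by rewrite /theta; field; rewrite gt_eqF.
by rewrite /dot /=; field; rewrite !gt_eqF.
Qed.

Local Notation walk_mgf := (mgf words (weight q) endpoint (fun n => 1 / an n)).

Lemma walk_mgf_gt0 (n : nat) (l : R * R) : 0 < walk_mgf n l.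
Proof.
have ge0 (w : seq 'I_3) (c : R) : 0 <= weight q w * expR c.
  by rewrite mulr_ge0 ?expR_ge0// weight_ge0.
rewrite lt_neqAle eq_sym sumr_ge0 ?andbT ?psumr_neq0//.
have : \sum_(w <- words n) weight q w != 0 by rewrite sum_weight ?oner_neq0.
rewrite psumr_neq0; last by move=> w _; exact: weight_ge0.
move=> /hasP[w wn /= qw]; apply/hasP; exists w => //=.
by rewrite mulr_gt0 ?expR_gt0.
Qed.

(** The scaled logarithm is the average over the steps of [ln (step_mgf ...) / theta n ^+ 2], which
    tends to half the variance in each phase. *)
Lemma walk_log_mgf_cvg (l : R * R) :
  (fun n => ln (walk_mgf n l) / (1 / an n)) @ \oo -->
  quadratic (sigma1sq a q) (sigma12 a q) (sigma2sq a q) l.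
Proof.
pose c i := (\sum_r q i r * (increment a l i r - drift a q l i) ^+ 2) / 2.
have -> : quadratic (sigma1sq a q) (sigma12 a q) (sigma2sq a q) l = (c 0 + c 1) / 2.
  by have := variance_sum a q_sum1 l; rewrite /c => h; lra.
have gc i : (fun n => ln (step_mgf a q l (theta n) i) / theta n ^+ 2) @ \oo --> c i.
  apply: log_mgf_second_order => //; [exact: theta_cvg0|exact: near_theta_gt0|].
  under eq_bigr do rewrite mulrBr.
  by rewrite sumrB -mulr_suml q_sum1 mul1r subrr.
apply: cvg_trans (cvg_phase_average gc); apply: near_eq_cvg; near=> n.
have n0 : (0 < n)%N by near: n; exact: nbhs_infty_gt.
have -> : walk_mgf n l = \prod_(k < n) step_mgf a q l (theta n) (phase k).
  rewrite -word_mgf; apply: eq_bigr => w _.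
  by rewrite dot_endpoint.
rewrite ln_prod_step_mgf// -mulr_suml div1r invrK [in RHS]theta_sqr//.
by rewrite -mulrA -invfM (mulrC (_ ^+ 2)).
Unshelve. all: by end_near. Qed.

Lemma walk_speed : speed (fun n => 1 / an n).
Proof.
split=> [n n0|]; first by rewrite divr_gt0// an_gt0.
apply/gtr0_cvgV0; first by near=> n; rewrite divr_gt0// an_gt0//; near: n; exact: nbhs_infty_gt.
apply: cvg_trans an_to0; apply: near_eq_cvg; apply: nearW => n.
by rewrite /= div1r invrK.
Unshelve. all: by end_near. Qed.

Lemma walk_law (n : nat) (B : set (R * R)) :
  P ((fun t => rescale n (X n t, Y n t)) @^-1` B) =
  (mass words (weight q) endpoint n B)%:E.
Proof.
exact: (prob_walk a_gt0 q_ge0 q_sum1 walk (measurable_walk (rescale n @^-1` B) n)).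
Qed.

End walk_moderate_deviations.

Theorem proposition4p2 (R : realType) (a : R) (q : 'I_2 -> 'I_3 -> R)
    (d : measure_display) (T : measurableType d) (P : probability T R)
    (X Y : nat -> {RV P >-> R})
    (a_gt0 : 0 < a)
    (q_ge0 : forall i r, 0 <= q i r)
    (q_sum1 : forall i, \sum_(r < 3) q i r = 1)
    (walk : hex_random_walk a q X Y)
    (an : nat -> R)
    (an_gt0 : forall n, (0 < n)%N -> 0 < an n)
    (an_to0 : an @ \oo --> 0)
    (nan_toy : (fun n => n%:R * an n) @ \oo --> +oo) :
  LDP P
    (fun n t =>
       (Num.sqrt (n%:R * an n) * ((X n t - fine 'E_P[X n]) / n%:R),
        Num.sqrt (n%:R * an n) * ((Y n t - fine 'E_P[Y n]) / n%:R)))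
    (fun n => 1 / an n)
    (Lambda_tilde_star a q)
  /\ good_rate_function (Lambda_tilde_star a q).
Proof.
rewrite Lambda_tilde_starE.
set L := quadratic _ _ _.
have L0 : L (0, 0) = 0 by rewrite /L /quadratic /=; ring.
split; last by split=> [|eta _]; [exact: legendre_rate|exact: legendre_compact].
(* The measures put mass [weight q w] at the rescaled endpoint of each word [w] of length [n]. *)
apply: (gartner_ellis (s := words) (p := weight q) (z := endpoint a X Y an)) => //.
- by move=> w; exact: weight_ge0.
- exact: walk_speed.
- exact: walk_mgf_gt0.
- by move=> l; exact: walk_log_mgf_cvg.
- by move=> n _ O _; exact: (measurable_walk walk (rescale X Y an n @^-1` O)).
- by move=> n B _; exact: walk_law.
- move=> x /legendre_quadratic_gradient[l ->]; exists l => u eps.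
  exact: quadratic_gradient.
Qed.
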